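(* Let $(M,g)$ be a Riemannian manifold with $\dim M\geq 3$. Then the flat Riemannian $g$-natural metrics are the only $g$-natural metrics on $TM$ that have constant sectional curvature; that is, a Riemannian $g$-natural metric $G$ on $TM$ has constant sectional curvature if and only if $(TM,G)$ is flat.
   Context: $\mathbb{R}^+=[0,\infty)$. Let $\nabla$ be the Levi-Civita connection of $(M,g)$ and $\pi:TM\to M$ the projection. The tangent space splits as $T_{(x,u)}TM=H_{(x,u)}M\oplus V_{(x,u)}M$ into horizontal (with respect to $\nabla$) and vertical subspaces. For $X\in T_xM$, the horizontal lift $X^h\in H_{(x,u)}M$ is the unique horizontal vector with $\pi_*X^h=X$, and the vertical lift $X^v\in V_{(x,u)}M$ is the vertical vector with $X^v(df)=X(f)$ for all functions $f$ on $M$, where $df$ is viewed as the function $(x,u)\mapsto u(f)$ on $TM$. A $g$-natural metric $G$ on $TM$ is a symmetric $(0,2)$-tensor field on $TM$ obtained from $g$ by a first order natural operator; equivalently, it is given by smooth functions $\alpha_i,\beta_i:\mathbb{R}^+\to\mathbb{R}$, $i=1,2,3$ (with $\beta_i=0$ if $\dim M=1$), such that for all $x\in M$ and $u,X,Y\in T_xM$, with $t=g_x(u,u)$, $$G_{(x,u)}(X^h,Y^h)=(\alpha_1+\alpha_3)(t)g_x(X,Y)+(\beta_1+\beta_3)(t)g_x(X,u)g_x(Y,u),$$ $$G_{(x,u)}(X^h,Y^v)=G_{(x,u)}(X^v,Y^h)=\alpha_2(t)g_x(X,Y)+\beta_2(t)g_x(X,u)g_x(Y,u),$$ $$G_{(x,u)}(X^v,Y^v)=\alpha_1(t)g_x(X,Y)+\beta_1(t)g_x(X,u)g_x(Y,u).$$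 $G$ is called Riemannian if it is positive definite. Flat means that the Riemannian curvature vanishes identically. *)

(* Defs.v *)
From mathcomp Require Import all_boot all_order all_algebra.
From mathcomp Require Import all_classical all_reals all_analysis.
Set Implicit Arguments.
Unset Strict Implicit.
Unset Printing Implicit Defensive.
Import Order.TTheory GRing.Theory Num.Theory.
Import numFieldNormedType.Exports.
Local Open Scope classical_set_scope.
Local Open Scope ring_scope.

Definition partial (R : realType) n (i : 'I_n) (f : 'rV[R]_n -> R) :
  'rV[R]_n -> R := fun x => 'D_(delta_mx 0 i) f x.

(* C^infty on an open set U: every iterated partial derivative is
   differentiable (hence continuous) at every point of U. *)
Definition smooth_on (R : realType) n (U : set 'rV[R]_n) (f : 'rV[R]_n -> R) :=
  forall (s : seq 'I_n) (x : 'rV[R]_n), U x ->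
    differentiable (foldr (@partial R n) f s) x.

Definition smooth_map_on (R : realType) n m (U : set 'rV[R]_n)
    (F : 'rV[R]_n -> 'rV[R]_m) :=
  forall j, smooth_on U (fun x => F x 0 j).

(* Smooth functions on [0, +oo[: those that extend smoothly to the real line.
   Values at negative arguments are irrelevant. *)
Definition smooth_nneg (R : realType) (f : R -> R) :=
  exists2 F : R -> R,
    forall (k : nat) (t : R), derivable (derive1n k F) t 1 &
    forall t : R, 0 <= t -> F t = f t.

(* [minv a] is only meaningful on the image of the chart [mchart a], and
   [mchart a] is only meaningful on its domain [mdom a]. *)
Record manifold (R : realType) (n : nat) := Manifold {
  mcarrier :> topologicalType;
  mhausdorff : hausdorff_space mcarrier;
  msecond_countable : @second_countable mcarrier;
  midx : Type;
  mdom : midx -> set mcarrier;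
  mchart : midx -> mcarrier -> 'rV[R]_n;
  minv : midx -> 'rV[R]_n -> mcarrier;
  mcover : forall x, exists a, mdom a x;
  mdom_open : forall a, open (mdom a);
  mimage_open : forall a, open (mchart a @` mdom a);
  mchartK : forall a x, mdom a x -> minv a (mchart a x) = x;
  mchart_continuous : forall a x, mdom a x -> {for x, continuous (mchart a)};
  minv_continuous : forall a y, (mchart a @` mdom a) y ->
    {for y, continuous (minv a)};
  mtrans_smooth : forall a b,
    smooth_map_on (mchart a @` (mdom a `&` mdom b)) (mchart b \o minv a)
}.

(* A manifold as seen through its atlas: the images [aim a] of the charts in
   R^n, the image [aoverlap a b] in the chart a of the overlap with the chart
   b, and the change of coordinates [atrans a b] from a to b. Tensor fields
   are given by their components in the charts, related on the overlaps. *)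
Record atlas (R : realType) (n : nat) := Atlas {
  aidx : Type;
  aim : aidx -> set 'rV[R]_n;
  aoverlap : aidx -> aidx -> set 'rV[R]_n;
  atrans : aidx -> aidx -> 'rV[R]_n -> 'rV[R]_n
}.

Definition atlas_of (R : realType) n (M : manifold R n) : atlas R n := {|
  aidx := midx M;
  aim a := mchart a @` mdom a;
  aoverlap a b := mchart a @` (mdom a `&` mdom b);
  atrans a b := mchart b \o minv a
|}.

(* The atlas induced on the tangent bundle: the vector u^i d/dx^i at the point
   of coordinates x has coordinates [row_mx x u], so that a chart of TM is
   onto [aim a] x R^n, and a change of coordinates tau of M induces
   (x, u) |-> (tau x, d tau_x u). *)
Definition tangent_atlas (R : realType) n (A : atlas R n) : atlas R (n + n) := {|
  aidx := aidx A;
  aim a := [set p | aim a (lsubmx p)];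
  aoverlap a b := [set p | aoverlap a b (lsubmx p)];
  atrans a b p := row_mx (atrans a b (lsubmx p))
                         ('d (atrans a b) (lsubmx p) (rsubmx p))
|}.

Definition bform (R : realType) n (h : 'M[R]_n) (X Y : 'rV[R]_n) : R :=
  (X *m h *m Y^T) 0 0.

Record sym2_tensor (R : realType) n (A : atlas R n) := Sym2Tensor {
  tcomp :> aidx A -> 'rV[R]_n -> 'M[R]_n;
  tcomp_smooth : forall a i j, smooth_on (aim a) (fun x => tcomp a x i j);
  tcomp_sym : forall a x, aim a x -> (tcomp a x)^T = tcomp a x;
  tcomp_trans : forall a b x, aoverlap a b x -> forall X Y,
    bform (tcomp a x) X Y =
    bform (tcomp b (atrans a b x)) ('d (atrans a b) x X) ('d (atrans a b) x Y)
}.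

Definition riemannian (R : realType) n (A : atlas R n) (h : sym2_tensor A) :=
  forall a x, aim a x -> forall X, X != 0 -> 0 < bform (h a x) X X.

(* Gamma^k_ij of the Levi-Civita connection, where nabla_(d_i) d_j = Gamma^k_ij d_k
   and h is the matrix of the metric in a chart. *)
Definition christoffel (R : realType) n (h : 'rV[R]_n -> 'M[R]_n)
    (x : 'rV[R]_n) (k i j : 'I_n) : R :=
  2^-1 * \sum_l invmx (h x) k l *
    (partial i (fun y => h y j l) x + partial j (fun y => h y i l) x
     - partial l (fun y => h y i j) x).

(* R^l_kij, where R(d_i, d_j) d_k = R^l_kij d_l and
   R(X, Y) = [nabla_X, nabla_Y] - nabla_[X, Y]. *)
Definition riemann_coef (R : realType) n (h : 'rV[R]_n -> 'M[R]_n)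
    (x : 'rV[R]_n) (l k i j : 'I_n) : R :=
  partial i (fun y => christoffel h y l j k) x
  - partial j (fun y => christoffel h y l i k) x
  + \sum_m (christoffel h x m j k * christoffel h x l i m
            - christoffel h x m i k * christoffel h x l j m).

(* R(X, Y) Z *)
Definition curvature (R : realType) n (h : 'rV[R]_n -> 'M[R]_n)
    (x X Y Z : 'rV[R]_n) : 'rV[R]_n :=
  \row_l \sum_i \sum_j \sum_k X 0 i * Y 0 j * Z 0 k * riemann_coef h x l k i j.

Definition sectional_curvature (R : realType) n (h : 'rV[R]_n -> 'M[R]_n)
    (x X Y : 'rV[R]_n) : R :=
  bform (h x) (curvature h x X Y Y) X /
  (bform (h x) X X * bform (h x) Y Y - bform (h x) X Y ^+ 2).

Definition flat (R : realType) n (A : atlas R n) (h : sym2_tensor A) :=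
  forall a x, aim a x -> forall X Y Z, curvature (h a) x X Y Z = 0.

(* [row_free (col_mx X Y)]: X and Y span a plane. *)
Definition constant_sectional_curvature (R : realType) n (A : atlas R n)
    (h : sym2_tensor A) :=
  exists K : R, forall a x, aim a x -> forall X Y, row_free (col_mx X Y) ->
    sectional_curvature (h a) x X Y = K.

(* Lifts to the point p = (x, u) of TM. The horizontal subspace is
   { (X, W) | W^k + Gamma^k_ij u^i X^j = 0 }. In a chart the function df is
   (x, u) |-> u^i d_i f (x), so that (0, X) is the vertical vector which maps
   df to X(f). *)
Definition hlift (R : realType) n (h : 'rV[R]_n -> 'M[R]_n)
    (p : 'rV[R]_(n + n)) (X : 'rV[R]_n) : 'rV[R]_(n + n) :=
  row_mx X (- \row_k \sum_i \sum_j
    christoffel h (lsubmx p) k i j * rsubmx p 0 i * X 0 j).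

Definition vlift (R : realType) n (X : 'rV[R]_n) : 'rV[R]_(n + n) :=
  row_mx 0 X.

Definition g_natural (R : realType) n (A : atlas R n) (g : sym2_tensor A)
    (G : sym2_tensor (tangent_atlas A)) :=
  exists alpha1 alpha2 alpha3 beta1 beta2 beta3 : R -> R,
  [/\ [/\ smooth_nneg alpha1, smooth_nneg alpha2 & smooth_nneg alpha3],
      [/\ smooth_nneg beta1, smooth_nneg beta2 & smooth_nneg beta3],
      n = 1%N -> forall t, 0 <= t ->
        [/\ beta1 t = 0, beta2 t = 0 & beta3 t = 0] &
      forall (a : aidx A) (p : 'rV[R]_(n + n)), aim a (lsubmx p) ->
      forall X Y : 'rV[R]_n,
      let u := rsubmx p in
      let gx := bform (g a (lsubmx p)) in
      let Gp := bform (G a p) in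
      let Xh := hlift (g a) p X in
      let Yh := hlift (g a) p Y in
      let t := gx u u in
      [/\ Gp Xh Yh = (alpha1 t + alpha3 t) * gx X Y
                     + (beta1 t + beta3 t) * gx X u * gx Y u,
          Gp Xh (vlift Y) = alpha2 t * gx X Y + beta2 t * gx X u * gx Y u,
          Gp (vlift X) Yh = alpha2 t * gx X Y + beta2 t * gx X u * gx Y u &
          Gp (vlift X) (vlift Y) = alpha1 t * gx X Y + beta1 t * gx X u * gx Y u]].

(* Main.v *)
(* Write a = (alpha1 + alpha3)(0), b = alpha2(0), c = alpha1(0). The functions
   alpha_i, beta_i enter G through t = g(u, u), which vanishes to second order
   on the zero section. So at u = 0 the Levi-Civita connection of G depends on
   that of g only, and, for all tangent vectors X, Y, Z of M,
     R^G(X^h, Y^h) Z^h = (R(X, Y) Z)^h,  R^G(X^h, Y^h) Z^v = (R(X, Y) Z)^v.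
   If G has constant curvature K, then R^G(X, Y) Z = K (<Y, Z> X - <X, Z> Y);
   with rho = g(R(X, Y) Y, X) and D the Gram determinant of X and Y for g, the
   two identities give a rho = K a^2 D and c rho = K b^2 D. Hence
   K a (a c - b^2) D = 0, and a, a c - b^2, D are positive. *)
Require Import Defs.
From mathcomp Require Import all_boot all_order all_algebra.
From mathcomp Require Import all_classical all_reals all_analysis.
From mathcomp Require Import ring lra.
Set Implicit Arguments.
Unset Strict Implicit.
Unset Printing Implicit Defensive.
Import Order.TTheory GRing.Theory Num.Theory.
Import numFieldNormedType.Exports.
Local Open Scope classical_set_scope.
Local Open Scope ring_scope.

(** * Symmetry of second directional derivatives *)

Section DirectionalDerivatives.
Variables (R : realType) (V : normedModType R).
Implicit Types (f : V -> R) (x v w : V).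

Lemma derive_line f x v : 'D_v f x = 'D_1 (fun s : R => f (s *: v + x)) 0.
Proof.
rewrite /derive; set g1 := fun h => h^-1 *: _; set g2 := fun h => h^-1 *: _.
suff -> : g1 = g2 by [].
by rewrite funeqE /g1 /g2 => h /=; rewrite addr0 scale0r add0r [_%:A]mulr1.
Qed.

Lemma is_derive_line f x v s : derivable f (s *: v + x) v ->
  is_derive s 1 (fun s : R => f (s *: v + x)) ('D_v f (s *: v + x)).
Proof.
move=> df.
have E : (fun h : R => h^-1 *: (f ((h *: 1 + s) *: v + x) - f (s *: v + x))) =
         (fun h => h^-1 *: (f (h *: v + (s *: v + x)) - f (s *: v + x))).
  by apply/funext => h; rewrite [_%:A]mulr1 scalerDl addrA.
split; first by rewrite /derivable E.
by rewrite /derive E.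
Qed.

(** The mean value theorem along v turns the second difference into h times a difference of values
    of ['D_v f] at two points near x. Expanding both values to first order at x, the contributions
    of the direction v cancel and h times the derivative along w remains, with an error o(h). *)
Lemma second_difference_bound f x v w (e : R) : 0 < e ->
  (\forall y \near x, derivable f y v) -> differentiable ('D_v f) x ->
  exists2 d, 0 < d & forall h, 0 < h -> h < d ->
  `|f (h *: v + (h *: w + x)) - f (h *: w + x) - f (h *: v + x) + f x
    - h ^+ 2 * 'D_w ('D_v f) x| <= e * h ^+ 2.
Proof.
move=> e0 dv ddv.
(* The two expansions are made at distance at most h (|v| + |w|) and h |v| from x, so a relative
   error e / m in each adds up to at most e h. The summand 1 keeps m positive when v = w = 0. *)
pose m := 2 * `|v| + `|w| + 1.
have m0 : 0 < m by rewrite ltr_pwDr// addr_ge0// mulr_ge0.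
have em0 : 0 < e / m by rewrite divr_gt0.
have /eqaddoP /(_ _ em0) := diff_locally ddv.
rewrite -nbhs_nearE => /nbhs_ballP[d1 /= d10 B1].
move: dv; rewrite -nbhs_nearE => /nbhs_ballP[d2 /= d20 B2].
pose d := Num.min d1 d2 / m.
have md : 0 < Num.min d1 d2 by rewrite lt_min d10.
exists d; first by rewrite divr_gt0.
move=> h h0 hd.
have norm_le (s t : R) : 0 <= s <= h -> 0 <= t <= h ->
    `|s *: v + t *: w| <= h * (`|v| + `|w|).
  move=> /andP[s0 sh] /andP[t0 th].
  rewrite (le_trans (ler_normD _ _))// !normrZ !ger0_norm// mulrDr.
  by rewrite lerD// ler_wpM2r.
have norm_lt (s t : R) : 0 <= s <= h -> 0 <= t <= h ->
    `|s *: v + t *: w| < Num.min d1 d2.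
  move=> hs ht; rewrite (le_lt_trans (norm_le _ _ hs ht))//.
  have := hd; rewrite /d ltr_pdivlMr// => hdm; apply: le_lt_trans hdm.
  rewrite ler_pM2l// /m; have := normr_ge0 v; lra.
have dvf (s t : R) : 0 <= s <= h -> 0 <= t <= h ->
    derivable f (s *: v + (t *: w + x)) v.
  move=> hs ht; apply: B2; rewrite -ball_normE /= addrA opprD addrCA subrr addr0.
  by rewrite normrN; have := norm_lt _ _ hs ht; rewrite lt_min => /andP[].
have D (s t : R) : 0 <= s <= h -> 0 <= t <= h ->
   `|'D_v f (s *: v + (t *: w + x)) - 'D_v f x
     - (s * 'd ('D_v f) x v + t * 'd ('D_v f) x w)|
     <= e / m * `|s *: v + t *: w|.
  move=> hs ht.
  have B k : ball 0 d1 k ->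
    `|'D_v f (k + x) - ('D_v f x + 'd ('D_v f) x k)| <= e / m * `|k|.
    exact: B1.
  have := B (s *: v + t *: w).
  have -> : 'd ('D_v f) x (s *: v + t *: w) =
      s * 'd ('D_v f) x v + t * 'd ('D_v f) x w by rewrite linearD !linearZ.
  rewrite -[s *: v + t *: w + x]addrA -[X in _ -> `|X| <= _]addrA -opprD; apply.
  rewrite -ball_normE /= add0r normrN.
  by have := norm_lt _ _ hs ht; rewrite lt_min => /andP[].
have hh : 0 <= h <= h by rewrite ltW//=.
have h00 : 0 <= (0 : R) <= h by rewrite lexx ltW.
(* The term [0 *: w] gives both summands the same shape, so that [dvf] serves for each. *)
pose phi s := f (s *: v + (h *: w + x)) - f (s *: v + (0 *: w + x)).
pose dphi s := 'D_v f (s *: v + (h *: w + x)) - 'D_v f (s *: v + (0 *: w + x)).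
have dP s : 0 <= s <= h -> is_derive s 1 phi (dphi s).
  move=> hs; apply: is_deriveB; apply: is_derive_line; exact: dvf.
have [c ch] : exists2 c, c \in `]0, h[%R & phi h - phi 0 = dphi c * (h - 0).
  apply: MVT => //.
    by move=> s; rewrite in_itv /= => /andP[s0 sh]; apply: dP; rewrite !ltW.
  apply: continuous_in_subspaceT => s; rewrite inE /= in_itv /= => hs.
  apply: differentiable_continuous; apply/derivable1_diffP.
  by have [] := dP _ hs.
move: ch; rewrite in_itv /= => /andP[c0 ch].
have hc : 0 <= c <= h by rewrite !ltW.
rewrite subr0 /phi /dphi !scale0r !add0r => E.
have D1 := D c h hc hh.
have D2 := D c 0 hc h00; rewrite !scale0r addr0 add0r mul0r addr0 in D2.
have N1 := norm_le _ _ hc hh.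
have N2 := norm_le _ _ hc h00; rewrite scale0r addr0 in N2.
rewrite (deriveE w ddv).
have -> : f (h *: v + (h *: w + x)) - f (h *: w + x) - f (h *: v + x) + f x -
   h ^+ 2 * 'd ('D_v f) x w = h * (
     ('D_v f (c *: v + (h *: w + x)) - 'D_v f x - (c * 'd ('D_v f) x v + h * 'd ('D_v f) x w)) 
    - ('D_v f (c *: v + x) - 'D_v f x - c * 'd ('D_v f) x v)).
  set a := f (h *: v + (h *: w + x)) in E *; set b := f (h *: v + x) in E *.
  have -> : a - f (h *: w + x) - b + f x = a - b - (f (h *: w + x) - f x) by ring.
  by rewrite E; ring.
rewrite normrM gtr0_norm//.
have -> : e * h ^+ 2 = h * (e * h) by ring.
rewrite ler_pM2l// (le_trans (ler_normB _ _))//.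
rewrite (le_trans (lerD D1 D2))// -mulrDr.
have N2' : `|c *: v| <= h * `|v|.
  by rewrite normrZ gtr0_norm// ler_wpM2r// ltW.
rewrite -mulrA ler_pM2l// mulrC ler_pdivrMr//.
rewrite (le_trans (lerD N1 N2'))// -mulrDr ler_pM2l// /m; lra.
Qed.

(** The second difference is symmetric in v and w, and both iterated derivatives approximate its
    quotient by h^2 with error e / 2. *)
Lemma derive_swap f x v w :
  (\forall y \near x, derivable f y v) -> (\forall y \near x, derivable f y w) ->
  differentiable ('D_v f) x -> differentiable ('D_w f) x ->
  'D_w ('D_v f) x = 'D_v ('D_w f) x.
Proof.
move=> dv dw ddv ddw; apply/eqP; rewrite -subr_eq0 -normr_eq0 eq_le normr_ge0 andbT.
apply/ler_addgt0Pr => e e0; rewrite add0r.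
have e2 : 0 < e / 2 by rewrite divr_gt0.
have [d1 d10 B1] := second_difference_bound w e2 dv ddv.
have [d2 d20 B2] := second_difference_bound v e2 dw ddw.
have [h h0 [h1 h2]] : exists2 h : R, 0 < h & h < d1 /\ h < d2.
  have m0 : 0 < Num.min d1 d2 by rewrite lt_min d10.
  exists (Num.min d1 d2 / 2); first by rewrite divr_gt0.
  by apply/andP; rewrite -lt_min; lra.
have {}B1 := B1 _ h0 h1; have {}B2 := B2 _ h0 h2.
have hh : 0 < h ^+ 2 by rewrite exprn_gt0.
rewrite -(ler_pM2l hh) -[X in X * `|_|]gtr0_norm// -normrM.
move: B1 B2; rewrite [h *: w + (h *: v + x)]addrCA.
move: (f (h *: v + _)) (f (h *: w + x)) (f (h *: v + x)) (f x)
  ('D_w ('D_v f) x) ('D_v ('D_w f) x) => F a b c L1 L2 B1 B2.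
have -> : h ^+ 2 * (L1 - L2) =
  (F - b - a + c - h ^+ 2 * L2) - (F - a - b + c - h ^+ 2 * L1) by ring.
rewrite (le_trans (ler_normB _ _))// (le_trans (lerD B2 B1))//; lra.
Qed.

End DirectionalDerivatives.

(** * Finite sums, and differentiability of determinants and inverse matrices *)

Lemma sum_mul_delta (R : pzRingType) (I : finType) (F : I -> R) (i : I) :
  \sum_j F j * (i == j)%:R = F i.
Proof.
rewrite (bigD1 i)//= eqxx mulr1 big1 ?addr0// => j /negbTE.
by rewrite eq_sym => ->; rewrite mulr0.
Qed.

Lemma differentiable_bigprod (R : realType) (V : normedModType R) (I : Type) (r : seq I)
    (f : I -> V -> R) (x : V) :
  (forall i, differentiable (f i) x) ->
  differentiable (fun y => \prod_(i <- r) f i y) x.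
Proof.
move=> df; elim: r => [|i r IH].
  under eq_fun do rewrite big_nil; exact: differentiable_cst.
under eq_fun do rewrite big_cons; exact: differentiableM.
Qed.

Lemma differentiable_bigsum (R : realType) (V : normedModType R) (I : Type) (r : seq I)
    (f : I -> V -> R) (x : V) :
  (forall i, differentiable (f i) x) ->
  differentiable (fun y => \sum_(i <- r) f i y) x.
Proof.
move=> df; elim: r => [|i r IH].
  under eq_fun do rewrite big_nil; exact: differentiable_cst.
under eq_fun do rewrite big_cons; exact: differentiableD.
Qed.

Lemma differentiable_det (R : realType) (V : normedModType R) m (A : V -> 'M[R]_m) (x : V) :
  (forall i j, differentiable (fun y => A y i j) x) ->
  differentiable (fun y => \det (A y)) x.
Proof.
move=> dA; apply: differentiable_bigsum => s.
apply: differentiableM; first exact: differentiable_cst.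
exact: differentiable_bigprod.
Qed.

(** The function is the entry (k, l) of the inverse matrix, written without the case distinction in
    [invmx]; the adjugate transposes, whence the order l k in [cofactor]. *)
Lemma differentiable_inv_cofactor (R : realType) (V : normedModType R) m
    (A : V -> 'M[R]_m) (x : V) k l :
  (forall i j, differentiable (fun y => A y i j) x) ->
  (\forall y \near x, A y \in unitmx) ->
  differentiable (fun y => (\det (A y))^-1 * cofactor (A y) l k) x.
Proof.
move=> dA uA; apply: differentiableM.
  apply: differentiableV; first exact: differentiable_det.
  by have := nbhs_singleton uA; rewrite unitmxE unitfE.
rewrite /cofactor; apply: differentiableM; first exact: differentiable_cst.
apply: differentiable_det => i j.
by under eq_fun do rewrite !mxE; exact: dA.
Qed.

(** * Metrics in one chart, for M and TM alike: Levi-Civita connection and symmetries of the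
    curvature *)

Record local_metric (R : realType) (n : nat) (U : set 'rV[R]_n)
    (h : 'rV[R]_n -> 'M[R]_n) : Prop := LocalMetric {
  lm_open : open U;
  lm_smooth : forall i j, smooth_on U (fun x => h x i j);
  lm_tr : forall x, U x -> (h x)^T = h x;
  lm_pos : forall x, U x -> forall X, X != 0 -> 0 < bform (h x) X X
}.

Section LocalMetricTheory.
Variables (R : realType) (n : nat) (U : set 'rV[R]_n) (h : 'rV[R]_n -> 'M[R]_n).
Hypothesis hU : local_metric U h.
Implicit Types (x : 'rV[R]_n) (i j k l : 'I_n).

Local Notation Gam := (christoffel h).

Lemma lm_near x : U x -> \forall y \near x, U y.
Proof. by move=> Ux; have := lm_open hU; rewrite openE; apply. Qed.

Lemma lm_sym x i j : U x -> h x i j = h x j i.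
Proof. by move=> /(lm_tr hU) {1}<-; rewrite mxE. Qed.

Lemma lm_unit x : U x -> h x \in unitmx.
Proof.
move=> Ux; rewrite -row_free_unit; apply/inj_row_free => v vh.
apply/eqP; apply/negP => /negP /(lm_pos hU Ux).
by rewrite /bform vh mul0mx mxE ltxx.
Qed.

Lemma partial_lm_sym x l i j : U x ->
  partial l (fun y => h y i j) x = partial l (fun y => h y j i) x.
Proof.
move=> Ux; apply: near_eq_derive; apply: filterS (lm_near Ux) => y Uy.
exact: lm_sym.
Qed.

Lemma christoffel_sym x k i j : U x -> Gam x k i j = Gam x k j i.
Proof.
move=> Ux; rewrite /christoffel; congr (_ * _); apply: eq_bigr => l _.
by rewrite (partial_lm_sym _ _ _ Ux) (partial_lm_sym _ i j Ux); congr (_ * _); ring.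
Qed.

(** Lowering the upper index cancels the inverse matrix and leaves the Christoffel symbols of the
    first kind. *)
Lemma christoffel_lower x i j w : U x ->
  \sum_k Gam x k i j * h x k w = 2^-1 *
    (partial i (fun y => h y j w) x + partial j (fun y => h y i w) x
     - partial w (fun y => h y i j) x).
Proof.
move=> Ux; rewrite /christoffel.
pose T l := partial i (fun y => h y j l) x + partial j (fun y => h y i l) x
  - partial l (fun y => h y i j) x.
under eq_bigr => k _ do rewrite -mulrA mulr_suml -/(T _).
rewrite -mulr_sumr exchange_big /=; congr (_ * _).
have E l : \sum_k invmx (h x) k l * T l * h x k w = T l * (w == l)%:R.
  under eq_bigr => k _ do rewrite (lm_sym _ _ Ux) mulrAC mulrC [X in T l * X]mulrC.
  rewrite -mulr_sumr; congr (_ * _).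
  have := mulmxV (lm_unit Ux) => /matrixP /(_ w l); rewrite !mxE => <-.
  by apply: eq_bigr.
rewrite (eq_bigr _ (fun l _ => E l)); exact: sum_mul_delta.
Qed.

(** The equation nabla h = 0 in coordinates: in the sum of two symbols of the first kind, all
    derivatives but one cancel. *)
Lemma metric_compat x c a b : U x -> partial c (fun y => h y a b) x =
  \sum_m (Gam x m c a * h x m b + Gam x m c b * h x m a).
Proof.
move=> Ux; rewrite big_split /= !christoffel_lower//.
rewrite (partial_lm_sym c b a Ux) (partial_lm_sym a c b Ux) (partial_lm_sym b c a Ux).
rewrite (partial_lm_sym a b c Ux); lra.
Qed.

(** The Koszul argument: combining the compatibility equation for three permutations of its indices
    determines the lowered symbols, and h is invertible. It is stated at a single point, so that
    symbols can be guessed and checked at that point without inverting the metric. *)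
Lemma christoffel_unique x (B : 'I_n -> 'I_n -> 'I_n -> R) : U x ->
  (forall k i j, B k i j = B k j i) ->
  (forall c a b, partial c (fun y => h y a b) x =
     \sum_m (B m c a * h x m b + B m c b * h x m a)) ->
  forall k i j, Gam x k i j = B k i j.
Proof.
move=> Ux Bsym Bc k i j.
have L w : \sum_k Gam x k i j * h x k w = \sum_k B k i j * h x k w.
  rewrite christoffel_lower// !Bc !big_split /=.
  have -> : \sum_m B m j i * h x m w = \sum_m B m i j * h x m w.
    by apply: eq_bigr => m _; rewrite Bsym.
  have -> : \sum_m B m j w * h x m i = \sum_m B m w j * h x m i.
    by apply: eq_bigr => m _; rewrite Bsym.
  have -> : \sum_m B m i w * h x m j = \sum_m B m w i * h x m j.
    by apply: eq_bigr => m _; rewrite Bsym.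
  lra.
pose u := \row_k Gam x k i j; pose v := \row_k B k i j.
have E : u *m h x = v *m h x.
  by apply/rowP => w; rewrite !mxE; under eq_bigr do rewrite mxE;
    under [RHS]eq_bigr do rewrite mxE; rewrite L.
have : u = v by rewrite -[u](mulmxK (lm_unit Ux)) E mulmxK// lm_unit.
by move=> /rowP /(_ k); rewrite !mxE.
Qed.

Lemma derivable_entry x v i j : U x -> derivable (fun y => h y i j) x v.
Proof. by move=> Ux; apply/diff_derivable/(lm_smooth hU i j [::] Ux). Qed.

Lemma differentiable_partial_entry x l i j : U x ->
  differentiable (partial l (fun y => h y i j)) x.
Proof. by move=> Ux; exact: (lm_smooth hU i j [:: l] Ux). Qed.

Lemma derivable_christoffel x v k i j : U x -> derivable (fun y => Gam y k i j) x v.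
Proof.
move=> Ux.
(* The same symbol with the inverse expressed by cofactors; the two agree near x because h is
   invertible on U. *)
pose f y := 2^-1 * \sum_l (\det (h y))^-1 * cofactor (h y) l k *
    (partial i (fun y => h y j l) y + partial j (fun y => h y i l) y
     - partial l (fun y => h y i j) y).
apply: (@near_eq_derivable _ _ _ f).
  apply: filterS (lm_near Ux) => y Uy; rewrite /f /christoffel.
  congr (_ * _); apply: eq_bigr => l _; rewrite /invmx (lm_unit Uy).
  by rewrite !mxE.
apply: diff_derivable; apply: differentiableM; first exact: differentiable_cst.
apply: differentiable_bigsum => l; apply: differentiableM.
  apply: differentiable_inv_cofactor.
    by move=> a b; exact: (lm_smooth hU a b [::] Ux).
  by apply: filterS (lm_near Ux) => y; exact: lm_unit.
apply: differentiableB; last exact: differentiable_partial_entry.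
by apply: differentiableD; exact: differentiable_partial_entry.
Qed.

Local Opaque christoffel.

Lemma partial_swap_entry x i j a b : U x ->
  partial i (partial j (fun y => h y a b)) x =
  partial j (partial i (fun y => h y a b)) x.
Proof.
move=> Ux; apply: derive_swap.
- by apply: filterS (lm_near Ux) => y Uy; exact: derivable_entry.
- by apply: filterS (lm_near Ux) => y Uy; exact: derivable_entry.
- exact: differentiable_partial_entry.
- exact: differentiable_partial_entry.
Qed.

(** Metric compatibility holds in a neighbourhood of x, so it can be differentiated once more by the
    Leibniz rule. *)
Lemma partial2_entry x i j a b : U x ->
  partial i (partial j (fun y => h y a b)) x =
  \sum_m ((partial i (fun y => Gam y m j a) x * h x m b
           + Gam x m j a * partial i (fun y => h y m b) x)
        + (partial i (fun y => Gam y m j b) x * h x m a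
           + Gam x m j b * partial i (fun y => h y m a) x)).
Proof.
move=> Ux.
pose T m y := Gam y m j a * h y m b + Gam y m j b * h y m a.
have -> : partial i (partial j (fun y => h y a b)) x = partial i (\sum_m T m) x.
  apply: near_eq_derive; apply: filterS (lm_near Ux) => y Uy.
  by rewrite metric_compat// fct_sumE.
have dT m k l c d : derivable (fun y => Gam y m k l * h y c d) x (delta_mx 0 i).
  by apply: derivableM; [exact: derivable_christoffel|exact: derivable_entry].
rewrite /partial derive_sum; last by move=> m; exact: derivableD.
apply: eq_bigr => m _; rewrite deriveD//.
have E k l c d : 'D_(delta_mx 0 i) (fun y => Gam y m k l * h y c d) x =
   'D_(delta_mx 0 i) (fun y => Gam y m k l) x * h x c d
   + Gam x m k l * 'D_(delta_mx 0 i) (fun y => h y c d) x.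
  rewrite deriveM; [|exact: derivable_christoffel|exact: derivable_entry].
  by rewrite addrC /GRing.scale /= [X in X + _ = _]mulrC.
by rewrite !E.
Qed.

(** The commutator of two partial derivatives vanishes on the entries of h. Expanded by metric
    compatibility used twice, it is the lowered curvature symmetrized in k and w. *)
Lemma riemann_coef_skew x i j k w : U x ->
  \sum_l (riemann_coef h x l k i j * h x l w + riemann_coef h x l w i j * h x l k) = 0.
Proof.
move=> Ux.
(* [S] and [Q] are the derivative part and the quadratic part of the lowered curvature; [C] gathers
   the products pairing two symbols through h, which enter symmetrically in the two differentiation
   indices and drop out of the commutator. *)
pose S i j k w := \sum_l partial i (fun y => Gam y l j k) x * h x l w.
pose Q i j k w := \sum_m \sum_l Gam x m j k * Gam x l i m * h x l w.
pose C i j k w := \sum_m \sum_l Gam x m j k * Gam x l i w * h x l m.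
have E a b : partial a (partial b (fun y => h y k w)) x =
    S a b k w + S a b w k + (Q a b k w + Q a b w k + (C a b k w + C b a k w)).
  have -> : C b a k w = C a b w k.
    rewrite /C exchange_big; apply: eq_bigr => m _; apply: eq_bigr => p _.
    by rewrite (lm_sym _ _ Ux) mulrAC mulrC mulrA [X in X * _]mulrC mulrAC.
  rewrite partial2_entry// /S.
  have -> : Q a b k w + Q a b w k + (C a b k w + C a b w k) =
    \sum_m (Gam x m b k * partial a (fun y => h y m w) x
           + Gam x m b w * partial a (fun y => h y m k) x).
    rewrite -!big_split /=; apply: eq_bigr => m _.
    rewrite !metric_compat// !mulr_sumr -!big_split; apply: eq_bigr => p _ /=.
    move: (Gam x m b k) (Gam x m b w) (Gam x p a m) (Gam x p a w) (Gam x p a k)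
      (h x p w) (h x p m) (h x p k) => *; ring.
  by rewrite -!big_split; apply: eq_bigr => m _ /=; exact: addrACA.
have Rk u v : \sum_l riemann_coef h x l u i j * h x l v =
    S i j u v - S j i u v + (Q i j u v - Q j i u v).
  rewrite [Q i j u v]exchange_big [Q j i u v]exchange_big.
  rewrite -!sumrB -big_split; apply: eq_bigr => l _ /=.
  rewrite /riemann_coef mulrDl mulrBl mulr_suml -sumrB; congr (_ + _).
  by apply: eq_bigr => m _; rewrite mulrBl.
have := partial_swap_entry i j k w Ux; rewrite big_split /= !E !Rk.
move: (S i j k w) (S i j w k) (S j i k w) (S j i w k) (Q i j k w) (Q i j w k)
  (Q j i k w) (Q j i w k) (C i j k w) (C j i k w) => *; lra.
Qed.

(** Since the symbols are symmetric in the lower indices (no torsion), derivatives and products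
    cancel in pairs around the cycle: the first Bianchi identity. *)
Lemma riemann_coef_bianchi x i j k l : U x ->
  riemann_coef h x l k i j + riemann_coef h x l i j k + riemann_coef h x l j k i = 0.
Proof.
move=> Ux.
have P a b c : partial a (fun y => Gam y l b c) x = partial a (fun y => Gam y l c b) x.
  apply: near_eq_derive; apply: filterS (lm_near Ux) => y; exact: christoffel_sym.
rewrite /riemann_coef (P i k j) (P j k i) (P k j i).
set A := \sum_m _; set B := \sum_m _; set D := \sum_m _.
have : A + B + D = 0.
  rewrite /A /B /D -!big_split big1//= => m _.
  rewrite (christoffel_sym _ k i Ux) (christoffel_sym _ j i Ux) (christoffel_sym _ k j Ux).
  move: (Gam x m j k) (Gam x l i m) (Gam x m i k) (Gam x l j m) (Gam x m i j)
    (Gam x l k m) => *; ring.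
move: A B D (partial _ _ x) (partial _ _ x) (partial _ _ x) => *; lra.
Qed.

End LocalMetricTheory.

(** * Bilinear forms, Gram determinants and algebraic curvature tensors *)

Section BilinearForms.
Variables (R : realType) (n : nat).
Implicit Types (h : 'M[R]_n) (X Y Z : 'rV[R]_n).

Lemma bformE h X Y : bform h X Y = \sum_i \sum_j X 0 i * h i j * Y 0 j.
Proof.
rewrite /bform -mulmxA mxE; apply: eq_bigr => i _.
by rewrite mxE mulr_sumr; apply: eq_bigr => j _; rewrite mxE mulrA.
Qed.

Lemma bform_delta h i j : bform h (delta_mx 0 i) (delta_mx 0 j) = h i j.
Proof. by rewrite /bform -rowE trmx_delta -colE !mxE. Qed.

Lemma bformDl h X Y Z : bform h (X + Y) Z = bform h X Z + bform h Y Z.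
Proof. by rewrite /bform !mulmxDl mxE. Qed.

Lemma bformDr h X Y Z : bform h Z (X + Y) = bform h Z X + bform h Z Y.
Proof. by rewrite /bform linearD mulmxDr mxE. Qed.

Lemma bformZl h (a : R) X Y : bform h (a *: X) Y = a * bform h X Y.
Proof. by rewrite /bform -!scalemxAl mxE. Qed.

Lemma bformZr h (a : R) X Y : bform h X (a *: Y) = a * bform h X Y.
Proof. by rewrite /bform linearZ -scalemxAr mxE. Qed.

Lemma bformNl h X Y : bform h (- X) Y = - bform h X Y.
Proof. by rewrite -scaleN1r bformZl mulN1r. Qed.

Lemma bformNr h X Y : bform h X (- Y) = - bform h X Y.
Proof. by rewrite -scaleN1r bformZr mulN1r. Qed.

Lemma bform0l h X : bform h 0 X = 0.
Proof. by rewrite /bform !mul0mx mxE. Qed.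

Lemma bform0r h X : bform h X 0 = 0.
Proof. by rewrite /bform trmx0 mulmx0 mxE. Qed.

Lemma bform_tr h X Y : bform h X Y = bform h^T Y X.
Proof. by rewrite /bform -[in RHS](trmxK Y) -!trmx_mul mulmxA [RHS]mxE. Qed.

Lemma bform_sym h X Y : h^T = h -> bform h X Y = bform h Y X.
Proof. by move=> hT; rewrite bform_tr hT. Qed.

Lemma bform_eq0 h X : (forall Z, Z != 0 -> 0 < bform h Z Z) ->
  (forall Y, bform h X Y = 0) -> X = 0.
Proof.
move=> hp X0; apply/eqP; apply/negP => /negP /hp.
by rewrite X0 ltxx.
Qed.

(* The vector [<Y, Y> X - <X, Y> Y] has square norm [<Y, Y>] times the Gram
   determinant, so it is enough that it does not vanish. *)
Lemma gram_gt0 h X Y : h^T = h -> (forall Z, Z != 0 -> 0 < bform h Z Z) ->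
  row_free (col_mx X Y) -> 0 < bform h X X * bform h Y Y - bform h X Y ^+ 2.
Proof.
move=> hT hp fXY.
have free a b : a *: X + b *: Y = 0 -> a = 0 /\ b = 0.
  move=> E; have := row_free_inj fXY; move=> /(_ 1 (row_mx a%:M b%:M) 0).
  rewrite mul_row_col !mul_scalar_mx mul0mx => /(_ E) /matrixP H.
  have := H 0 (lshift 1 0); have := H 0 (rshift 1 0).
  by rewrite row_mxEl row_mxEr !mxE eqxx !mulr1n => -> ->.
have Y0 : Y != 0.
  apply/eqP => Y0; have [_ /eqP] : (0 : R) = 0 /\ (1 : R) = 0.
    by apply: free; rewrite Y0 scaler0 scale0r add0r.
  by rewrite oner_eq0.
have hY := hp _ Y0.
have /hp : bform h Y Y *: X - bform h X Y *: Y != 0.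
  apply/eqP; rewrite -scaleNr => /free[/eqP]; by rewrite gt_eqF.
rewrite !(bformDl, bformDr, bformNl, bformNr, bformZl, bformZr).
rewrite [bform h Y X]bform_sym//.
set a := bform h X X; set b := bform h Y Y; set c := bform h X Y.
have E p : p = b * (a * b - c ^+ 2) -> 0 < p -> 0 < a * b - c ^+ 2.
  by move=> ->; rewrite pmulr_rgt0.
by apply: E; ring.
Qed.

End BilinearForms.

(** Polarizing T(X, Y, Y, X) = 0 first in X and then in Y makes T skew in its two middle arguments.
    With the skewness in the first two, T is invariant under cyclic permutations of the first three
    arguments, and the Bianchi identity becomes 3 T = 0. *)
Lemma curvature_like_eq0 (R : realFieldType) (V : zmodType) (T : V -> V -> V -> V -> R) :
  (forall X X' Y Z W, T (X + X') Y Z W = T X Y Z W + T X' Y Z W) ->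
  (forall X Y Z W, T X Y Z W = - T Y X Z W) ->
  (forall X Y Z W, T X Y Z W = - T X Y W Z) ->
  (forall X Y Z W, T X Y Z W + T Y Z X W + T Z X Y W = 0) ->
  (forall X Y, T X Y Y X = 0) ->
  forall X Y Z W, T X Y Z W = 0.
Proof.
move=> TD a12 a34 bi T0.
(* The classical pair symmetry, obtained by adding the Bianchi identity for the four cyclic
   rotations of the arguments; it carries additivity over to the other slots. *)
have pair X Y Z W : T X Y Z W = T Z W X Y.
  have b1 := bi X Y Z W.
  have := bi Y Z W X; rewrite (a34 Y Z W X) (a34 Z W Y X) => b2.
  have := bi Z W X Y; rewrite (a12 X Z W Y) (a34 Z X W Y) => b3.
  have := bi W X Y Z; rewrite (a34 W X Y Z) (a34 X Y W Z) (a12 Y W X Z) (a34 W Y X Z) => b4.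
  lra.
have D2 X Y Y' Z W : T X (Y + Y') Z W = T X Y Z W + T X Y' Z W.
  by rewrite a12 TD opprD -!a12.
have D4 X Y Z W W' : T X Y Z (W + W') = T X Y Z W + T X Y Z W'.
  by rewrite pair D2 -!(pair X).
have D3 X Y Z Z' W : T X Y (Z + Z') W = T X Y Z W + T X Y Z' W.
  by rewrite a34 D4 opprD -!a34.
have T1 X Y W : T X Y Y W = 0.
  have := T0 (X + W) Y; rewrite TD !D4 !T0.
  have -> : T W Y Y X = T X Y Y W by rewrite pair a12 a34 opprK.
  lra.
have T2 X Y Z W : T X Y Z W = - T X Z Y W.
  by have := T1 X (Y + Z) W; rewrite D2 !D3 !T1; lra.
move=> X Y Z W.
have := bi X Y Z W; have := T2 X Y Z W; have := T2 Y Z X W.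
rewrite (a12 X Z Y W) (a12 Y X Z W); lra.
Qed.

(** * The curvature operator, and its determination by constant sectional curvature *)

Section Curvature.
Variables (R : realType) (n : nat) (h : 'rV[R]_n -> 'M[R]_n).
Implicit Types (x X Y Z W : 'rV[R]_n).

Local Notation rc := (riemann_coef h).

(** The endomorphism R(X, Y), acting on row vectors from the right; hence the lower index labels the
    rows. *)
Definition curvature_mx x X Y : 'M[R]_n :=
  \matrix_(k, l) \sum_i \sum_j X 0 i * Y 0 j * rc x l k i j.

Lemma curvatureE x X Y Z : curvature h x X Y Z = Z *m curvature_mx x X Y.
Proof.
apply/rowP => l; rewrite !mxE.
under [RHS]eq_bigr => k _ do rewrite mxE mulr_sumr.
rewrite [RHS]exchange_big; apply: eq_bigr => i _ /=.
under [RHS]eq_bigr => k _ do rewrite mulr_sumr.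
rewrite [RHS]exchange_big; apply: eq_bigr => j _ /=.
by apply: eq_bigr => k _; rewrite mulrA [_ * Z 0 k]mulrC.
Qed.

Lemma curvature_mxDl x X X' Y :
  curvature_mx x (X + X') Y = curvature_mx x X Y + curvature_mx x X' Y.
Proof.
apply/matrixP => k l; rewrite !mxE -big_split; apply: eq_bigr => i _ /=.
by rewrite -big_split; apply: eq_bigr => j _ /=; rewrite mxE !mulrDl.
Qed.

Lemma curvature_mxZl x (a : R) X Y :
  curvature_mx x (a *: X) Y = a *: curvature_mx x X Y.
Proof.
apply/matrixP => k l; rewrite !mxE mulr_sumr; apply: eq_bigr => i _ /=.
by rewrite mulr_sumr; apply: eq_bigr => j _ /=; rewrite mxE !mulrA.
Qed.

Lemma riemann_coef_anti x l k i j : rc x l k i j = - rc x l k j i.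
Proof.
rewrite /riemann_coef.
have -> : \sum_m (christoffel h x m j k * christoffel h x l i m -
   christoffel h x m i k * christoffel h x l j m) =
  - (\sum_m (christoffel h x m i k * christoffel h x l j m -
   christoffel h x m j k * christoffel h x l i m)).
  by rewrite -sumrN; apply: eq_bigr => m _; rewrite opprB.
by rewrite opprD opprB.
Qed.

Lemma curvature_mx_anti x X Y : curvature_mx x X Y = - curvature_mx x Y X.
Proof.
apply/matrixP => k l; rewrite !mxE exchange_big -sumrN; apply: eq_bigr => i _ /=.
rewrite -sumrN; apply: eq_bigr => j _ /=.
by rewrite riemann_coef_anti mulrN [X 0 j * _]mulrC.
Qed.

Variable U : set 'rV[R]_n.
Hypothesis hU : local_metric U h.

(** Multiplication by [h x] lowers the upper index, so this is the skew-adjointness of R(X, Y),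
    entry by entry [riemann_coef_skew]. *)
Lemma curvature_mx_skew x X Y : U x ->
  (curvature_mx x X Y *m h x)^T = - (curvature_mx x X Y *m h x).
Proof.
move=> Ux; apply/eqP; rewrite -addr_eq0; apply/eqP/matrixP => k w; rewrite !mxE.
have E a b : \sum_l curvature_mx x X Y a l * h x l b =
    \sum_i \sum_j X 0 i * Y 0 j * \sum_l rc x l a i j * h x l b.
  under eq_bigr => l _ do rewrite mxE mulr_suml.
  rewrite exchange_big; apply: eq_bigr => i _ /=.
  under eq_bigr => l _ do rewrite mulr_suml.
  rewrite exchange_big; apply: eq_bigr => j _ /=.
  by rewrite mulr_sumr; apply: eq_bigr => l _; rewrite mulrA.
rewrite !E -big_split big1//= => i _; rewrite -big_split big1//= => j _.
by rewrite -mulrDr -big_split (riemann_coef_skew hU)// mulr0.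
Qed.

Lemma curvature_bianchi x X Y Z : U x ->
  curvature h x X Y Z + curvature h x Y Z X + curvature h x Z X Y = 0.
Proof.
move=> Ux; apply/rowP => l; rewrite !mxE.
have -> : \sum_i \sum_j \sum_k Y 0 i * Z 0 j * X 0 k * rc x l k i j =
    \sum_i \sum_j \sum_k X 0 i * Y 0 j * Z 0 k * rc x l i j k.
  under eq_bigr do rewrite exchange_big.
  rewrite exchange_big; apply: eq_bigr => i _ /=.
  by apply: eq_bigr => j _; apply: eq_bigr => k _; ring.
have -> : \sum_i \sum_j \sum_k Z 0 i * X 0 j * Y 0 k * rc x l k i j =
    \sum_i \sum_j \sum_k X 0 i * Y 0 j * Z 0 k * rc x l j k i.
  rewrite exchange_big; apply: eq_bigr => i _ /=; rewrite exchange_big.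
  by apply: eq_bigr => j _; apply: eq_bigr => k _; ring.
rewrite -!big_split big1//= => i _; rewrite -!big_split big1//= => j _.
rewrite -!big_split big1//= => k _.
by rewrite -!mulrDr (riemann_coef_bianchi hU)// mulr0.
Qed.

Local Notation g x := (bform (h x)).

(** The difference of the two sides has all the symmetries of a curvature tensor and vanishes on (X,
    Y, Y, X), so [curvature_like_eq0] applies. The argument is pointwise in x. *)
Lemma sectional_curvatureK x (K : R) : U x ->
  (forall X Y, row_free (col_mx X Y) -> sectional_curvature h x X Y = K) ->
  forall X Y Z W, g x (curvature h x X Y Z) W =
    K * (g x Y Z * g x X W - g x X Z * g x Y W).
Proof.
move=> Ux hK X Y Z W; apply/eqP; rewrite -subr_eq0; apply/eqP.
pose T X Y Z W := g x (curvature h x X Y Z) W -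
  K * (g x Y Z * g x X W - g x X Z * g x Y W).
have hT := lm_tr hU Ux; have hp := lm_pos hU Ux.
have gs A B : g x A B = g x B A by exact: bform_sym.
rewrite -/(T X Y Z W); apply: curvature_like_eq0 X Y Z W; rewrite /T.
- by move=> X X' Y Z W; rewrite !curvatureE curvature_mxDl mulmxDr !bformDl; ring.
- move=> X Y Z W; rewrite !curvatureE curvature_mx_anti mulmxN bformNl; ring.
- move=> X Y Z W; rewrite !curvatureE.
  have E A B : g x (A *m curvature_mx x X Y) B = bform (curvature_mx x X Y *m h x) A B.
    by rewrite /bform mulmxA.
  rewrite !E [bform _ Z W]bform_tr curvature_mx_skew//.
  have -> : bform (- (curvature_mx x X Y *m h x)) W Z =
    - bform (curvature_mx x X Y *m h x) W Z by rewrite /bform mulmxN mulNmx mxE.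
  ring.
- move=> X Y Z W.
  have := congr1 (fun V => g x V W) (curvature_bianchi X Y Z Ux).
  rewrite /= !bformDl bform0l (gs Z X) (gs Z Y) (gs Y X); lra.
- move=> X Y; have [fXY|] := boolP (row_free (col_mx X Y)).
    have := gram_gt0 hT hp fXY => /lt0r_neq0 G0.
    rewrite -(hK _ _ fXY) /sectional_curvature (gs Y X).
    rewrite [bform _ Y Y * bform _ X X]mulrC -expr2 divfK ?subrr//.
  (* For dependent X and Y the hypothesis says nothing, but then both terms vanish: either Y = 0, or
     X is a multiple of Y and R(Y, Y) = 0. *)
  move=> nf.
  have [Y0|Y0] := eqVneq Y 0.
    by rewrite Y0 curvatureE mul0mx !bform0l !bform0r; ring.
  have [c ->] : exists c, X = c *: Y.
    apply: contrapT => nXY; case/negP: nf; apply/inj_row_free => v.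
    rewrite -[v]hsubmxK mul_row_col [lsubmx v]mx11_scalar [rsubmx v]mx11_scalar.
    rewrite !mul_scalar_mx; set a := lsubmx v 0 0; set b := rsubmx v 0 0 => ab.
    have [a0|a0] := eqVneq a 0.
      move: ab; rewrite a0 scale0r add0r => /eqP; rewrite scaler_eq0 (negbTE Y0) orbF.
      by move=> /eqP ->; rewrite !raddf0 row_mx0.
    case: nXY; exists (- (a^-1 * b)).
    have /eqP := ab; rewrite addr_eq0 => /eqP aX.
    by rewrite -[LHS](scalerK a0) aX scalerN scalerA scaleNr.
  rewrite curvatureE curvature_mxZl.
  have -> : curvature_mx x Y Y = 0.
    apply/matrixP => k l; rewrite [RHS]mxE.
    have : curvature_mx x Y Y k l = - curvature_mx x Y Y k l.
      by rewrite {1}curvature_mx_anti mxE.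
    move: (curvature_mx x Y Y k l) => a; lra.
  rewrite scaler0 mulmx0 bform0l !bformZl !bformZr; ring.
Qed.

End Curvature.

(** * Connection and curvature of a natural metric along the zero section *)

Section NaturalMetricAlongZeroSection.
Variables (R : realType) (n : nat) (U : set 'rV[R]_n).
Variables (g : 'rV[R]_n -> 'M[R]_n) (G : 'rV[R]_(n + n) -> 'M[R]_(n + n)).
Hypothesis gU : local_metric U g.
Hypothesis GU : local_metric [set p | U (lsubmx p)] G.
(** These stand for alpha1 + alpha3, alpha2, alpha1 and the same combinations of the betas, extended
    to the whole line so that two-sided derivatives at t = 0 make sense. *)
Variables phh phv pvv qhh qhv qvv : R -> R.
Hypothesis dphh : forall t, derivable phh t 1.
Hypothesis dphv : forall t, derivable phv t 1.
Hypothesis dpvv : forall t, derivable pvv t 1.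
Hypothesis dqhh : forall t, derivable qhh t 1.
Hypothesis dqhv : forall t, derivable qhv t 1.
Hypothesis dqvv : forall t, derivable qvv t 1.
Hypothesis natural : forall p, U (lsubmx p) -> forall X Y,
  let u := rsubmx p in
  let gx := bform (g (lsubmx p)) in
  let t := gx u u in
  [/\ bform (G p) (hlift g p X) (hlift g p Y) = phh t * gx X Y + qhh t * gx X u * gx Y u,
      bform (G p) (hlift g p X) (vlift Y) = phv t * gx X Y + qhv t * gx X u * gx Y u,
      bform (G p) (vlift X) (hlift g p Y) = phv t * gx X Y + qhv t * gx X u * gx Y u &
      bform (G p) (vlift X) (vlift Y) = pvv t * gx X Y + qvv t * gx X u * gx Y u].

Implicit Types (x y u X Y P Q : 'rV[R]_n).

Local Notation a := (phh 0).
Local Notation b := (phv 0).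
Local Notation c := (pvv 0).

(* [nabla_u X] for a constant field X; the vertical component of the
   horizontal lift of X at (x, u) is [- cov x u X]. *)
Definition cov x u X : 'rV[R]_n :=
  \row_k \sum_i \sum_j christoffel g x k i j * u 0 i * X 0 j.

Lemma covZ x s u X : cov x (s *: u) X = s *: cov x u X.
Proof.
apply/rowP => k; rewrite !mxE mulr_sumr; apply: eq_bigr => i _.
by rewrite mulr_sumr; apply: eq_bigr => j _; rewrite mxE mulrCA -!mulrA mulrCA.
Qed.

Lemma cov_delta x i j k : cov x (delta_mx 0 i) (delta_mx 0 j) 0 k = christoffel g x k i j.
Proof.
rewrite mxE (bigD1 i)//= (bigD1 j)//= !mxE !eqxx !mulr1.
rewrite big1 ?addr0 => [|j' /negbTE j'j]; last by rewrite !mxE j'j mulr0.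
rewrite big1 ?addr0// => i' /negbTE i'i; rewrite big1// => j' _.
by rewrite !mxE i'i mulr0 mul0r.
Qed.

Lemma cov0r x u : cov x u 0 = 0.
Proof.
by apply/rowP => k; rewrite !mxE big1// => i _; rewrite big1// => j _; rewrite mxE mulr0.
Qed.

(** The splitting into horizontal and vertical parts: the lift of X already has the fibre component
    [- cov x u X], which the vertical part must compensate. *)
Lemma row_mx_lift x u X P :
  row_mx X P = hlift g (row_mx x u) X + vlift (P + cov x u X).
Proof.
by rewrite /hlift /vlift row_mxKl row_mxKr add_row_mx addr0 addrC addrK.
Qed.

Lemma bform_natural x u X P Y Q : U x ->
  let gx := bform (g x) in let t := gx u u in
  let P' := P + cov x u X in let Q' := Q + cov x u Y in
  bform (G (row_mx x u)) (row_mx X P) (row_mx Y Q) =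
    (phh t * gx X Y + qhh t * gx X u * gx Y u)
    + (phv t * gx X Q' + qhv t * gx X u * gx Q' u)
    + (phv t * gx P' Y + qhv t * gx P' u * gx Y u)
    + (pvv t * gx P' Q' + qvv t * gx P' u * gx Q' u).
Proof.
move=> Ux /=; rewrite (row_mx_lift x u X P) (row_mx_lift x u Y Q).
move: (P + cov x u X) (Q + cov x u Y) => P' Q'; rewrite !(bformDl, bformDr).
have Up : U (lsubmx (row_mx x u)) by rewrite row_mxKl.
have [-> _ _ _] := natural Up X Y; have [_ -> _ _] := natural Up X Q'.
have [_ _ -> _] := natural Up P' Y; have [_ _ _ ->] := natural Up P' Q'.
by rewrite !row_mxKl !row_mxKr !addrA.
Qed.

Lemma bform_zero x X P Y Q : U x ->
  bform (G (row_mx x 0)) (row_mx X P) (row_mx Y Q) =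
  a * bform (g x) X Y + b * (bform (g x) X Q + bform (g x) P Y) + c * bform (g x) P Q.
Proof.
move=> Ux; rewrite bform_natural//= !bform0r -(scale0r (0 : 'rV[R]_n)) !covZ !scale0r !addr0.
by rewrite !mulr0 !addr0 mulrDr !addrA.
Qed.

(** The first n coordinate directions are tangent to the zero section, so only the restriction of f
    to it matters. *)
Lemma partial_zero i (f : 'rV[R]_(n + n) -> R) x :
  partial (lshift n i) f (row_mx x 0) = partial i (fun y => f (row_mx y 0)) x.
Proof.
rewrite /partial (derive_line f) (derive_line _ x).
have -> : (fun s : R => f (s *: delta_mx 0 (lshift n i) + row_mx x 0)) =
          (fun s => f (row_mx (s *: delta_mx 0 i + x) 0)); last by [].
apply/funext => s.
by rewrite delta_mx_lshift scale_row_mx add_row_mx scaler0 addr0.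
Qed.

Lemma entry_zero x i j : U x ->
  [/\ G (row_mx x 0) (lshift n i) (lshift n j) = a * g x i j,
      G (row_mx x 0) (lshift n i) (rshift n j) = b * g x i j,
      G (row_mx x 0) (rshift n i) (lshift n j) = b * g x i j &
      G (row_mx x 0) (rshift n i) (rshift n j) = c * g x i j].
Proof.
move=> Ux; rewrite -!bform_delta !delta_mx_lshift !delta_mx_rshift !bform_zero//.
by rewrite !(bform0l, bform0r) !(mulr0, addr0, add0r) bform_delta.
Qed.

(** Along the ray s u in a fibre, t = s^2 g(u, u) is stationary at s = 0, so no derivative of a
    coefficient function survives there. *)
Lemma is_derive_comp_sqr (f : R -> R) tau : (forall t : R, derivable f t 1) ->
  is_derive (0 : R) 1 (fun s => f (s ^+ 2 * tau)) 0.
Proof.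
move=> df.
have d2 : is_derive (0 : R) (1 : R) (fun s : R => s ^+ 2 * tau) 0.
  apply: is_derive_eq; rewrite /GRing.scale /= !mulr0 !mul0r; ring.
have := @is_derive1_comp R f (fun s => s ^+ 2 * tau) 0 _ _ (derivableP (df _)) d2.
by rewrite mulr0.
Qed.

Lemma derive_fibre x u X P Y Q : U x ->
  'D_(row_mx 0 u) (fun p => bform (G p) (row_mx X P) (row_mx Y Q)) (row_mx x 0) =
  b * (bform (g x) X (cov x u Y) + bform (g x) (cov x u X) Y)
  + c * (bform (g x) P (cov x u Y) + bform (g x) (cov x u X) Q).
Proof.
move=> Ux; rewrite derive_line.
pose gx := bform (g x); pose tau := gx u u.
pose f (h : R -> R) s := h (s ^+ 2 * tau).
(* On the ray s u the metric is [E s + s * W s]: [E] is stationary at 0, and everything else has a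
   factor s, so the derivative sought is [W 0]. The terms with [qhh], [qhv], [qvv] contain two
   products with s u and keep a factor s even in [W]. *)
pose W := fun s : R => f qhh s * s * (gx X u * gx Y u)
  + f phv s * (gx X (cov x u Y) + gx (cov x u X) Y)
  + f qhv s * s * (gx X u * (gx Q u + s * gx (cov x u Y) u) +
                   gx Y u * (gx P u + s * gx (cov x u X) u))
  + f pvv s * (gx P (cov x u Y) + gx (cov x u X) Q + s * gx (cov x u X) (cov x u Y))
  + f qvv s * s * (gx P u + s * gx (cov x u X) u) * (gx Q u + s * gx (cov x u Y) u).
pose E := fun s : R => f phh s * gx X Y + f phv s * (gx X Q + gx P Y) + f pvv s * gx P Q.
have -> : (fun s : R => bform (G (s *: row_mx 0 u + row_mx x 0))
    (row_mx X P) (row_mx Y Q)) = (fun s => E s + s * W s).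
  apply/funext => s; rewrite scale_row_mx add_row_mx scaler0 add0r addr0.
  rewrite bform_natural// !covZ !(bformDl, bformDr, bformZl, bformZr) -/gx -/tau.
  rewrite mulrA -expr2 /E /W /f; ring.
have I (h : R -> R) : (forall t : R, derivable h t 1) -> is_derive (0 : R) (1 : R) (f h) 0.
  by move=> dh; exact: is_derive_comp_sqr.
have Ihh := I _ dphh; have Ihv := I _ dphv; have Ivv := I _ dpvv.
have Jhh := I _ dqhh; have Jhv := I _ dqhv; have Jvv := I _ dqvv.
have dE : is_derive (0 : R) (1 : R) E 0.
  by apply: is_derive_eq; rewrite /GRing.scale /= !mulr0 !addr0.
have dW : derivable W 0 1 by [].
have [_ ->] : is_derive (0 : R) (1 : R) (fun s => E s + s * W s) (W 0).
  have := derivableP dW => dW'; apply: is_derive_eq.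
  by rewrite /GRing.scale /= mul0r !add0r mulr1.
by rewrite /W /f expr0n !mul0r !mulr0 !mul0r !(addr0, add0r).
Qed.


Local Notation Gam := (christoffel g).

(* In terms of the base connection D, the derivative of (X, P) along (E, V) at a
   point of the zero section is (D_E X, D_E P + D_V X). *)
Definition zero_christoffel x (K I J : 'I_(n + n)) : R :=
  match fintype.split K, fintype.split I, fintype.split J with
  | inl k, inl i, inl j => Gam x k i j
  | inr k, inl i, inr j => Gam x k i j
  | inr k, inr i, inl j => Gam x k i j
  | _, _, _ => 0
  end.

Lemma split_lr : (forall i : 'I_n, fintype.split (lshift n i) = inl i) *
  (forall i : 'I_n, fintype.split (rshift n i) = inr i).
Proof. by split=> i; [exact: (unsplitK (inl i))|exact: (unsplitK (inr i))]. Qed.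

Lemma bform_cov_l x i j k : U x ->
  bform (g x) (cov x (delta_mx 0 i) (delta_mx 0 j)) (delta_mx 0 k) =
  \sum_m Gam x m i j * g x m k.
Proof.
move=> Ux; rewrite bformE; apply: eq_bigr => m _.
rewrite (bigD1 k)//= [in X in _ * _ * X]mxE !eqxx mulr1 cov_delta.
by rewrite big1 ?addr0// => l /negbTE lk; rewrite mxE lk andbF mulr0.
Qed.

(** By [christoffel_unique] it is enough that the proposed symbols are symmetric and compatible with
    G at the point. Derivatives along the zero section reduce to the compatibility for g, those
    along the fibre are given by [derive_fibre]. *)
Lemma christoffel_zero x K I J : U x ->
  christoffel G (row_mx x 0) K I J = zero_christoffel x K I J.
Proof.
move=> Ux.
have Uq : [set p : 'rV[R]_(n + n) | U (lsubmx p)] (row_mx x 0) by rewrite /mkset row_mxKl.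
apply: (christoffel_unique GU Uq) => {K I J} [K I J|I J K].
  rewrite /zero_christoffel; case: (split_ordP K) => k _; case: (split_ordP I) => i _;
    case: (split_ordP J) => j _ //; exact: (christoffel_sym gU).
have ez i j := entry_zero i j Ux.
case: (split_ordP I) => i ->.
  rewrite partial_zero big_split_ord /=.
  (* On the zero section each block of G is a constant multiple r of g. *)
  have D (f : 'rV[R]_n -> R) r A B : (forall y, U y -> f y = r * g y A B) ->
      partial i f x = r * \sum_m (Gam x m i A * g x m B + Gam x m i B * g x m A).
    move=> E; rewrite -(metric_compat gU)//.
    have -> : partial i f x = partial i (fun y => r * g y A B) x.
      by apply: near_eq_derive; apply: filterS (lm_near gU Ux) => y; exact: E.
    by apply: deriveZ; exact: (derivable_entry gU).
  case: (split_ordP J) => j ->; case: (split_ordP K) => k ->.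
  - rewrite (D _ a j k) => [|y Uy]; last by have [-> _ _ _] := entry_zero j k Uy.
    rewrite mulr_sumr -big_split; apply: eq_bigr => m _ /=.
    have [-> _ -> _] := ez m k; have [-> _ -> _] := ez m j.
    by rewrite /zero_christoffel !split_lr !mul0r !addr0 mulrDr !(mulrCA a).
  - rewrite (D _ b j k) => [|y Uy]; last by have [_ -> _ _] := entry_zero j k Uy.
    rewrite mulr_sumr -big_split; apply: eq_bigr => m _ /=.
    have [_ -> _ ->] := ez m k; have [-> _ -> _] := ez m j.
    by rewrite /zero_christoffel !split_lr !mul0r !addr0 !add0r mulrDr !(mulrCA b).
  - rewrite (D _ b j k) => [|y Uy]; last by have [_ _ -> _] := entry_zero j k Uy.
    rewrite mulr_sumr -big_split; apply: eq_bigr => m _ /=.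
    have [-> _ -> _] := ez m k; have [_ -> _ ->] := ez m j.
    by rewrite /zero_christoffel !split_lr !mul0r !addr0 !add0r mulrDr !(mulrCA b) addrC.
  - rewrite (D _ c j k) => [|y Uy]; last by have [_ _ _ ->] := entry_zero j k Uy.
    rewrite mulr_sumr -big_split; apply: eq_bigr => m _ /=.
    have [_ -> _ ->] := ez m k; have [_ -> _ ->] := ez m j.
    by rewrite /zero_christoffel !split_lr !mul0r !addr0 !add0r mulrDr !(mulrCA c).
have -> : partial (rshift n i) (fun p => G p J K) (row_mx x 0) =
  'D_(row_mx 0 (delta_mx 0 i)) (fun p => bform (G p) (delta_mx 0 J) (delta_mx 0 K))
     (row_mx x 0).
  by rewrite /partial delta_mx_rshift; under eq_fun do rewrite -bform_delta.
have gT A B : bform (g x) A B = bform (g x) B A.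
  by apply: bform_sym; exact: (lm_tr gU).
rewrite big_split_ord /=.
case: (split_ordP J) => j ->; case: (split_ordP K) => k ->;
  rewrite ?(delta_mx_lshift, delta_mx_rshift) derive_fibre//.
- rewrite !bform0l !bform0r add0r mulr0 addr0 gT !bform_cov_l//.
  rewrite -big_split mulr_sumr -big_split; apply: eq_bigr => m _ /=.
  have [-> _ -> _] := ez m k; have [-> _ -> _] := ez m j.
  rewrite /zero_christoffel !split_lr !mul0r !add0r.
  by rewrite mulrDr !(mulrCA b) addrC.
- rewrite !cov0r !bform0l !bform0r !add0r mulr0 add0r bform_cov_l//.
  rewrite mulr_sumr -big_split; apply: eq_bigr => m _ /=.
  have [_ -> _ ->] := ez m k.
  by rewrite /zero_christoffel !split_lr !mul0r !(add0r, addr0) mulrCA.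
- rewrite !cov0r !(bform0l, bform0r) !(add0r, mulr0, addr0) gT bform_cov_l//.
  rewrite mulr_sumr -big_split; apply: eq_bigr => m _ /=.
  have [_ -> _ ->] := ez m j.
  by rewrite /zero_christoffel !split_lr !mul0r !(add0r, addr0) mulrCA.
- rewrite !cov0r !(bform0l, bform0r, addr0, mulr0) -big_split big1// => m _ /=.
  by rewrite /zero_christoffel !split_lr !mul0r !addr0.
Qed.

(** With both form indices tangent to the zero section, the symbols of G are differentiated only
    along it, so their values on it suffice. There the symbols with such a first lower index are two
    diagonal copies of those of g. *)
Lemma riemann_coef_zero x k l i j : U x ->
  let q := row_mx x 0 in
  let rc K L := riemann_coef G q K L (lshift n i) (lshift n j) in
  [/\ rc (lshift n l) (lshift n k) = riemann_coef g x l k i j,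
      rc (lshift n l) (rshift n k) = 0,
      rc (rshift n l) (lshift n k) = 0 &
      rc (rshift n l) (rshift n k) = riemann_coef g x l k i j].
Proof.
move=> Ux /=.
have P m K I J : partial (lshift n m) (fun p => christoffel G p K I J) (row_mx x 0) =
    partial m (fun y => zero_christoffel y K I J) x.
  rewrite partial_zero; apply: near_eq_derive.
  by apply: filterS (lm_near gU Ux) => y Uy; exact: christoffel_zero.
have D0 m : partial m (fun=> 0 : R) x = 0 by exact: derive_cst.
rewrite /riemann_coef !P !big_split_ord /=.
split.
- rewrite /zero_christoffel !split_lr; congr (_ + _).
  rewrite [X in _ + X]big1 ?addr0 => [|m _].
    by apply: eq_bigr => m _; rewrite !christoffel_zero// /zero_christoffel !split_lr.
  by rewrite !christoffel_zero// /zero_christoffel !split_lr !mul0r subrr.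
- rewrite /zero_christoffel !split_lr !D0 subrr add0r.
  by rewrite !big1 ?addr0// => m _; rewrite !christoffel_zero// /zero_christoffel
    !split_lr ?mul0r ?mulr0 ?mul0r ?mulr0 subrr.
- rewrite /zero_christoffel !split_lr !D0 subrr add0r.
  by rewrite !big1 ?addr0// => m _; rewrite !christoffel_zero// /zero_christoffel
    !split_lr ?mul0r ?mulr0 ?mul0r ?mulr0 subrr.
- rewrite /zero_christoffel !split_lr; congr (_ + _).
  rewrite big1 ?add0r => [|m _].
    by apply: eq_bigr => m _; rewrite !christoffel_zero// /zero_christoffel !split_lr.
  by rewrite !christoffel_zero// /zero_christoffel !split_lr !mul0r subrr.
Qed.

(** At u = 0 the vectors (X, 0) and (0, Q) are the lifts X^h and Q^v, so this contains the
    identities for both kinds of lift. *)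
Lemma curvature_zero x X Y P Q : U x ->
  curvature G (row_mx x 0) (row_mx X 0) (row_mx Y 0) (row_mx P Q) =
  row_mx (curvature g x X Y P) (curvature g x X Y Q).
Proof.
move=> Ux; rewrite !curvatureE.
have -> : curvature_mx G (row_mx x 0) (row_mx X 0) (row_mx Y 0) =
    block_mx (curvature_mx g x X Y) 0 0 (curvature_mx g x X Y); last first.
  by rewrite mul_row_block !mulmx0 addr0 add0r.
have E K L : curvature_mx G (row_mx x 0) (row_mx X 0) (row_mx Y 0) K L =
   \sum_i \sum_j X 0 i * Y 0 j *
     riemann_coef G (row_mx x 0) L K (lshift n i) (lshift n j).
  rewrite mxE big_split_ord /= [X in _ + X]big1 ?addr0 => [|i _]; last first.
    by rewrite big1// => j _; rewrite row_mxEr mxE !mul0r.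
  apply: eq_bigr => i _; rewrite big_split_ord /= [X in _ + X]big1 ?addr0 => [|j _].
    by apply: eq_bigr => j _; rewrite !row_mxEl.
  by rewrite row_mxEr [X in _ * X * _]mxE mulr0 mul0r.
apply/matrixP => K L; rewrite E.
case: (split_ordP K) => k ->; case: (split_ordP L) => l ->.
- rewrite block_mxEul mxE; apply: eq_bigr => i _; apply: eq_bigr => j _.
  by have [-> _ _ _] := riemann_coef_zero k l i j Ux.
- rewrite block_mxEur mxE big1// => i _; rewrite big1// => j _.
  by have [_ _ -> _] := riemann_coef_zero k l i j Ux; rewrite mulr0.
- rewrite block_mxEdl mxE big1// => i _; rewrite big1// => j _.
  by have [_ -> _ _] := riemann_coef_zero k l i j Ux; rewrite mulr0.
- rewrite block_mxEdr mxE; apply: eq_bigr => i _; apply: eq_bigr => j _.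
  by have [_ _ _ ->] := riemann_coef_zero k l i j Ux.
Qed.

Lemma sectional_constant_eq0 x (K : R) : (1 < n)%N -> U x ->
  (forall V W, row_free (col_mx V W) -> sectional_curvature G (row_mx x 0) V W = K) ->
  K = 0.
Proof.
move=> n1 Ux hK.
have Uq : [set p : 'rV[R]_(n + n) | U (lsubmx p)] (row_mx x 0) by rewrite /mkset row_mxKl.
pose i0 := Ordinal (ltnW n1); pose i1 := Ordinal n1.
pose X : 'rV[R]_n := delta_mx 0 i0; pose Y : 'rV[R]_n := delta_mx 0 i1.
have XY : row_free (col_mx X Y).
  apply/inj_row_free => v.
  rewrite -[v]hsubmxK mul_row_col [lsubmx v]mx11_scalar [rsubmx v]mx11_scalar.
  rewrite !mul_scalar_mx => /rowP E.
  have := E i0; have := E i1; rewrite !mxE /= !mulr0 !mulr1 addr0 add0r.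
  by move=> -> ->; rewrite !raddf0 row_mx0.
have X0 : X != 0.
  by apply/eqP => /rowP /(_ i0) /eqP; rewrite !mxE !eqxx oner_eq0.
have gp := lm_pos gU Ux; have gT := lm_tr gU Ux.
have D0 := gram_gt0 gT gp XY; have XX := gp _ X0.
have a0 : 0 < a.
  have : row_mx X 0 != 0 :> 'rV[R]_(n + n) by rewrite row_mx_eq0 negb_and X0.
  move=> /(lm_pos GU Uq); rewrite bform_zero// !bform0l !bform0r !(addr0, mulr0).
  by rewrite pmulr_lgt0.
have abc : 0 < a * c - b ^+ 2.
  (* Up to a factor, X^v made orthogonal to X^h; its square norm is a (a c - b^2) g(X, X). *)
  have : row_mx (b *: X) (- a *: X) != 0 :> 'rV[R]_(n + n).
    by rewrite row_mx_eq0 negb_and !scaler_eq0 oppr_eq0 (gt_eqF a0) (negbTE X0) orbT.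
  move=> /(lm_pos GU Uq); rewrite bform_zero// !bformZl !bformZr.
  set S := bform _ _ _ in XX *.
  have E p : p = (a * S) * (a * c - b ^+ 2) -> 0 < p -> 0 < a * c - b ^+ 2.
    by move=> ->; rewrite pmulr_rgt0// mulr_gt0.
  by apply: E; ring.
have cK := sectional_curvatureK GU Uq hK.
have := cK (row_mx X 0) (row_mx Y 0) (row_mx Y 0) (row_mx X 0).
have := cK (row_mx X 0) (row_mx Y 0) (row_mx 0 Y) (row_mx 0 X).
rewrite !curvature_zero// !bform_zero// !(bform0l, bform0r, addr0, add0r, mulr0).
have -> : curvature g x X Y 0 = 0 by rewrite curvatureE mul0mx.
rewrite !(bform0l, bform0r, addr0, add0r, mulr0) [bform _ Y X]bform_sym//.
move: XX D0.
move: (bform (g x) X X) (bform (g x) Y Y) (bform (g x) X Y)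
  (bform (g x) (curvature g x X Y Y) X) => s t r rho s0 D0 E1 E2.
(* The curvature term [rho] of g is eliminated by taking c times the horizontal equation minus a
   times the vertical one. *)
have : K * (a * ((a * c - b ^+ 2) * (s * t - r ^+ 2))) = 0.
  have -> : K * (a * ((a * c - b ^+ 2) * (s * t - r ^+ 2))) =
    c * (K * (a * t * (a * s) - a * r * (a * r)))
    - a * (K * (b * t * (b * s) - b * r * (b * r))) by ring.
  by rewrite -E1 -E2; ring.
by move/eqP; rewrite mulf_eq0 [X in _ || X]gt_eqF ?orbF ?mulr_gt0// => /eqP.
Qed.

End NaturalMetricAlongZeroSection.

(** * From charts to the manifold *)

Lemma local_metric_of (R : realType) n (A : atlas R n) (h : sym2_tensor A) a :
  open (aim a) -> riemannian h -> local_metric (aim a) (h a).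
Proof.
move=> oa hp; split=> //; first exact: tcomp_smooth.
- exact: tcomp_sym.
- exact: hp.
Qed.

Lemma open_tangent_chart (R : realType) n (U : set 'rV[R]_n) :
  open U -> open [set p : 'rV[R]_(n + n) | U (lsubmx p)].
Proof.
apply: open_comp => p _; exact/differentiable_continuous/differentiable_lsubmx.
Qed.

Theorem proposition4p3 (R : realType) (n : nat) (hn : (3 <= n)%N)
  (M : manifold R n) (g : sym2_tensor (atlas_of M)) (hg : riemannian g)
  (G : sym2_tensor (tangent_atlas (atlas_of M)))
  (hnat : g_natural g G) (hG : riemannian G) :
  constant_sectional_curvature G <-> flat G.
Proof.
split=> [[K hK]|fG]; last first.
  exists 0 => a p Up X Y _.
  by rewrite /sectional_curvature fG// bform0l mul0r.
move=> a p Up X Y Z.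
have oU : open (@aim _ _ (atlas_of M) a) by exact: mimage_open.
have gU := local_metric_of oU hg.
have oTU : open (@aim _ _ (tangent_atlas (atlas_of M)) a) by exact: open_tangent_chart.
have GU := local_metric_of oTU hG.
(* K is the same at all points, so it can be computed at (x, 0), below the given p = (x, u); once K
   = 0, the constant curvature formula at p itself shows that the curvature is orthogonal to every
   vector. *)
suff K0 : K = 0.
  apply: (bform_eq0 (lm_pos GU Up)) => W.
  by rewrite (sectional_curvatureK GU Up (hK a p Up)) K0 mul0r.
have [a1 [a2 [a3 [b1 [b2 [b3 [[s1 s2 s3] [t1 t2 t3] _ nat]]]]]]] := hnat.
(* The smooth extensions replace the coefficient functions; they agree where they are evaluated,
   since g(u, u) is nonnegative. *)
have [A1 dA1 eA1] := s1; have [A2 dA2 eA2] := s2; have [A3 dA3 eA3] := s3.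
have [B1 dB1 eB1] := t1; have [B2 dB2 eB2] := t2; have [B3 dB3 eB3] := t3.
apply: (@sectional_constant_eq0 R n (@aim _ _ (atlas_of M) a) (g a) (G a) gU GU
  (fun t => A1 t + A3 t) A2 A1 (fun t => B1 t + B3 t) B2 B1 _ _ _ _ _ _ _
  (lsubmx p) K).
- by move=> t; apply: derivableD; [exact: (dA1 0%N)|exact: (dA3 0%N)].
- exact: (dA2 0%N).
- exact: (dA1 0%N).
- by move=> t; apply: derivableD; [exact: (dB1 0%N)|exact: (dB3 0%N)].
- exact: (dB2 0%N).
- exact: (dB1 0%N).
- move=> q Uq V W /=.
  have t0 : 0 <= bform (g a (lsubmx q)) (rsubmx q) (rsubmx q).
    have [->|u0] := eqVneq (rsubmx q) 0; first by rewrite bform0l.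
    exact/ltW/(lm_pos gU).
  rewrite (eA1 _ t0) (eA2 _ t0) (eA3 _ t0) (eB1 _ t0) (eB2 _ t0) (eB3 _ t0).
  exact: nat.
- exact: ltn_trans hn.
- exact: Up.
- by move=> V W; apply: (hK a); rewrite /= row_mxKl.
Qed.
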